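(* Let $\alpha$ be a composition of $n$. Then $$\mathcal{RS}_\alpha=\sum_\beta K(\alpha,\beta)^r M_\beta,$$ where the sum is over compositions $\beta$ of $n$ and $K(\alpha,\beta)^r$ is the number of row-strict composition tableaux of shape $\alpha$ and weight $\beta$.
   Context: A composition $\alpha=(\alpha_1,\ldots,\alpha_l)$ of $n$ is a finite sequence of positive integers summing to $n$. Its diagram has $l$ rows of left-justified cells, the $i$-th row from the top having $\alpha_i$ cells. Let $m$ be the largest part of $\alpha$. A row-strict composition tableau (RSCT) $F$ of shape $\alpha$ is a filling of the diagram with positive integers such that (1) entries strictly decrease in each row from left to right; (2) entries in the leftmost column weakly increase from top to bottom; (3) if $\hat F$ is the $l\times m$ array obtained from $F$ by adding cells with entry $0$ to the end of each row, then for $1\le i<j\le l$, $2\le k\le m$: $\hat F(j,k)>\hat F(i,k)$ implies $\hat F(j,k)\ge\hat F(i,k-1)$ (where $\hat F(i,j)$ is the entry in row $i$, column $j$). Put $x^F=\prod_i x_i^{w_i(F)}$ with $w_i(F)$ the number of occurrences of $i$ in $F$, and $\mathcal{RS}_\alpha=\sum_F x^F$ over all RSCTs $F$ of shape $\alpha$. An RSCT $F$ has weight $\beta=(\beta_1,\ldots,\beta_k)$ if $x^F=x_1^{\beta_1}\cdots x_k^{\beta_k}$. The monomial quasisymmetric function is $M_\beta=\sum_{i_1<\cdots<i_k}x_{i_1}^{\beta_1}\cdots x_{i_k}^{\beta_k}$. *)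

(* Defs.v *)
From HB Require Import structures.
From mathcomp Require Import all_boot all_order all_algebra finmap.
From mathcomp Require Import boolp classical_sets functions cardinality fsbigop.

Set Implicit Arguments.
Unset Strict Implicit.
Unset Printing Implicit Defensive.

Import GRing.Theory.
Local Open Scope classical_set_scope.
Local Open Scope ring_scope.

(* A composition (b_1, ..., b_k) is the sequence of its parts; n = 0 has the
   empty composition. *)
Definition is_composition (n : nat) (b : seq nat) : Prop :=
  all (leq 1) b /\ sumn b = n.

(* A monomial is its exponent function: [m i] is the exponent of x_i.  The
   variables of the theory are x_1, x_2, ...; x_0 never occurs below. *)
Definition monom := {fsfun nat -> nat with 0%N}.

(* x_{i_1}^{e_1} * ... * x_{i_k}^{e_k} *)
Definition xpow (idx e : seq nat) : monom :=
  [fsfun i in [fset i in idx]%fset =>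
     (\sum_(j < size idx | nth 0 idx j == i) nth 0 e j)%N].

(* Formal power series are coefficient functions; addition and natural
   multiples are the pointwise ones. *)
Notation fps R := (monom -> R).

Definition mono (R : comNzRingType) (m : monom) : fps R :=
  fun m' => (m' == m)%:R.

(* Coefficientwise sum of a possibly infinite family.  It is only meaningful
   when the family is [summable]: otherwise the coefficients that receive
   infinitely many contributions are 0. *)
Definition fsum (R : comNzRingType) (I : choiceType) (A : set I)
    (f : I -> fps R) : fps R :=
  fun m => \sum_(i \in A) f i m.

Definition summable (R : comNzRingType) (I : choiceType) (A : set I)
    (f : I -> fps R) : Prop :=
  forall m, finite_set (A `&` [set i | f i m != 0]).

(* A filling is the sequence of its rows, from top to bottom, so a filling of
   the diagram of a is an F with shape F = a.  Rows and columns are indexed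
   from 0. *)
Definition filling := seq (seq nat).

(* The array obtained by padding the rows with 0. *)
Definition hat (F : filling) (i j : nat) : nat := nth 0%N (nth [::] F i) j.

Definition max_part (a : seq nat) : nat := (\max_(x <- a) x)%N.

Definition is_rsct (a : seq nat) (F : filling) : Prop :=
  [/\ shape F = a,
      all (all (leq 1)) F,
      all (sorted gtn) F,
      sorted leq [seq hat F i 0 | i <- iota 0 (size a)]
    & forall i j k : nat, (i < j < size a)%N -> (1 <= k < max_part a)%N ->
        (hat F i k < hat F j k)%N -> (hat F i k.-1 <= hat F j k)%N].

(* x^F *)
Definition xF (F : filling) : monom :=
  [fsfun i in [fset i in flatten F]%fset => count_mem i (flatten F)].

Definition has_weight (F : filling) (b : seq nat) : Prop :=
  xF F = xpow (iota 1 (size b)) b.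

Definition RS (R : comNzRingType) (a : seq nat) : fps R :=
  fsum [set F | is_rsct a F] (fun F => mono R (xF F)).

(* Index sequences 0 < i_1 < ... < i_k. *)
Definition increasing_indices (k : nat) : set (seq nat) :=
  [set s | [/\ size s = k, all (leq 1) s & sorted ltn s]].

Definition M (R : comNzRingType) (b : seq nat) : fps R :=
  fsum (increasing_indices (size b)) (fun s => mono R (xpow s b)).

Definition rsct_of_weight (a b : seq nat) : set filling :=
  [set F | is_rsct a F /\ has_weight F b].

(* The set is finite by [finite_rsct_of_weight] below. *)
Definition K (a b : seq nat) : nat := #|` fset_set (rsct_of_weight a b)|.

(* None of the sums and cardinals above falls into its default value. *)

Lemma xFE F i : xF F i = count_mem i (flatten F).
Proof. by rewrite fsfunE inE /=; case: ifPn => // /count_memPn ->. Qed.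

Lemma xpowE s b i :
  xpow s b i = (\sum_(j < size s | nth 0 s j == i) nth 0 b j)%N.
Proof.
rewrite fsfunE inE /=; case: ifPn => // si; rewrite big1// => j /eqP ji.
by move: si; rewrite -ji mem_nth.
Qed.

Lemma finite_rsct_xF a m : finite_set [set F | is_rsct a F /\ xF F = m].
Proof.
have [->|/set0P[F0 [_ F0m]]] := eqVneq [set F | is_rsct a F /\ xF F = m] set0.
  exact: finite_set0.
apply: (@sub_finite_set _ _
  (reshape a @` [set` permutations (flatten F0)])).
  move=> F [[Fa _ _ _ _] Fm]; exists (flatten F); last by rewrite -Fa flattenK.
  rewrite /= mem_permutations; apply/allP => i _ /=.
  by rewrite -!xFE Fm F0m.
exact/finite_image/finite_seq.
Qed.

Lemma finite_rsct_of_weight a b : finite_set (rsct_of_weight a b).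
Proof. exact: finite_rsct_xF. Qed.

Lemma mono_neq0 (R : comNzRingType) m m' : mono R m m' != 0 -> m = m'.
Proof. by rewrite /mono; case: (eqVneq m' m) => [->|]; rewrite ?eqxx. Qed.

Lemma summable_RS (R : comNzRingType) a :
  summable [set F | is_rsct a F] (fun F => mono R (xF F)).
Proof.
move=> m; apply: sub_finite_set (finite_rsct_xF a m).
by move=> F [aF /mono_neq0].
Qed.

Lemma summable_M (R : comNzRingType) b : all (leq 1) b ->
  summable (increasing_indices (size b)) (fun s => mono R (xpow s b)).
Proof.
move=> b1 m.
apply: (@sub_finite_set _ _ [set` permutations (finsupp m)]); last first.
  exact: finite_seq.
move=> s [[sb _ s_lt] /mono_neq0 sm]; rewrite /= mem_permutations.
apply: uniq_perm; rewrite ?fset_uniq//.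
  by apply: (sorted_uniq ltn_trans ltnn).
move=> i; rewrite mem_finsupp -sm xpowE sum_nat_eq0.
apply/idP/forall_inPn => [si|[j ji _]]; last first.
  by move: ji; rewrite unfold_in => /eqP <-; exact: mem_nth.
have si' : (index i s < size s)%N by rewrite index_mem.
exists (Ordinal si'); first by apply/eqP; rewrite /= nth_index.
by rewrite -lt0n; apply: (allP b1); apply: mem_nth; rewrite -sb.
Qed.

Lemma finite_compositions n : finite_set [set b | is_composition n b].
Proof.
elim/ltn_ind: n => n IH.
apply: (@sub_finite_set _ _ ([set [::]] `|`
  \bigcup_(c in `I_n.+1 `&` [set c | (0 < c)%N])
     (cons c @` [set b | is_composition (n - c) b]))).
  move=> [|c b] [/= hb hn]; [by left|right; move: hb => /andP[c0 b0]].
  exists c; first by split=> //=; rewrite ltnS -hn leq_addr.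
  by exists b => //; split=> //; rewrite -hn addKn.
rewrite finite_setU; split; first exact: finite_set1.
apply: bigcup_finite; first exact/finite_setIl/finite_II.
move=> c [/= cn c0]; have [->|n0] := posnP n; last first.
  by apply/finite_image/IH; rewrite ltn_subrL c0.
apply: (@sub_finite_set _ _ [set [:: c]]); last exact: finite_set1.
move=> _ [b [b1 b0] <-] /=; congr cons.
by case: b b1 b0 => [//|x b] /= /andP[]; case: x.
Qed.

(* Main.v *)
Require Import Defs.
From HB Require Import structures.
From mathcomp Require Import all_boot all_order all_algebra finmap.
From mathcomp Require Import boolp classical_sets functions cardinality fsbigop.

(** Both sides are compared coefficient by coefficient.  A monomial in
    [x_1, x_2, ...] has exactly one expression [x_s^b] with [s] increasing and
    all parts of [b] positive ([xpow_inj]), so on the right-hand side the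
    coefficient of [x_s^b] receives the single term [K a b].  On the left-hand
    side it is the number of tableaux [F] with [x^F = x_s^b].

    These two numbers agree because the tableau conditions only compare
    entries with one another and with the padding value 0.  Replacing the
    entries along an order isomorphism that fixes 0 therefore preserves them
    ([is_rsct_map]), and the isomorphism from [0 :: s] to [0 :: iota 1 k] turns
    the tableaux with [x^F = x_s^b] into those of weight [b]
    ([card_rsct_xpow]).  A monomial that is no [x_s^b] with [b] a composition
    of [n] has coefficient 0 on both sides, since [x^F] always has this form
    ([rsct_xF_eq_xpow]). *)

Local Open Scope classical_set_scope.
Local Open Scope ring_scope.

Import GRing.Theory.

(** * Monomials as powers along an increasing index sequence *)

Lemma xpow_nth {s b : seq nat} {j : nat} : uniq s -> (j < size s)%N ->
  xpow s b (nth 0%N s j) = nth 0%N b j.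
Proof.
move=> us js; rewrite xpowE (big_pred1 (Ordinal js)) // => i /=.
by rewrite nth_uniq.
Qed.

Lemma xpow_notin {s b : seq nat} {i : nat} : i \notin s -> xpow s b i = 0%N.
Proof.
move=> si; rewrite xpowE big1 // => j /eqP ji.
by rewrite -ji mem_nth in si.
Qed.

Lemma increasing_uniq {k : nat} {s : seq nat} :
  increasing_indices k s -> uniq s.
Proof. by case=> _ _; apply: sorted_uniq; [exact: ltn_trans | exact: ltnn]. Qed.

Lemma increasing_cons0 {k : nat} {s : seq nat} :
  increasing_indices k s -> sorted ltn (0%N :: s).
Proof. by case: s => [|x s] [_ /= + xs] //= => /andP[-> _]. Qed.

Lemma xpow_neq0 {s b : seq nat} {i : nat} : all (leq 1) b ->
  increasing_indices (size b) s -> (i \in s) = (xpow s b i != 0%N).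
Proof.
move=> b1 sb; have us := increasing_uniq sb; case: sb => szs _ _.
have [si|/xpow_notin -> //] := boolP (i \in s).
have js : (index i s < size s)%N by rewrite index_mem.
rewrite -[in xpow _ _ i](nth_index 0%N si) xpow_nth // -lt0n.
by apply/esym/(allP b1)/mem_nth; rewrite -szs.
Qed.

(** The support of the monomial determines the increasing sequence of
    indices, and evaluating at these indices then determines the exponents. *)
Lemma xpow_inj {b c s t : seq nat} :
  all (leq 1) b -> all (leq 1) c ->
  increasing_indices (size b) s -> increasing_indices (size c) t ->
  xpow s b = xpow t c -> s = t /\ b = c.
Proof.
move=> b1 c1 sb tc st.
have eq_st : s = t.
  apply: (irr_sorted_eq ltn_trans ltnn); [by case: sb | by case: tc |].
  by move=> i; rewrite (xpow_neq0 b1 sb) (xpow_neq0 c1 tc) st.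
split=> //; subst t; have us := increasing_uniq sb.
case: sb tc => szb _ _ [szc _ _].
apply: (@eq_from_nth _ 0%N) => [|j]; first by rewrite -szb -szc.
by rewrite -szb => js; rewrite -(xpow_nth us js) st xpow_nth.
Qed.

(** * Monomials of fillings *)

Lemma xF_xpow_flatten {F : filling} {s b : seq nat} :
  xF F = xpow s b -> {subset flatten F <= s}.
Proof.
move=> Fs i iF; apply: contraLR iF => si.
by apply/count_memPn; rewrite -xFE Fs xpow_notin.
Qed.

Lemma xF_xpow_intro {F : filling} {s b : seq nat} :
  uniq s -> {subset flatten F <= s} ->
  (forall j, (j < size s)%N ->
     count_mem (nth 0%N s j) (flatten F) = nth 0%N b j) ->
  xF F = xpow s b.
Proof.
move=> us Fs cF; apply/fsfunP => i; rewrite xFE.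
have [/(nthP 0%N)[j js <-]|si] := boolP (i \in s).
  by rewrite cF // xpow_nth.
rewrite (xpow_notin si); apply/count_memPn.
by apply: contra si; exact: Fs.
Qed.

Lemma xF_degree {F : filling} :
  sumn [seq xF F i | i <- undup (flatten F)] = sumn (shape F).
Proof.
rewrite -size_flatten -(perm_size (perm_count_undup (flatten F))) size_flatten.
congr sumn; rewrite /shape -map_comp; apply: eq_map => i /=.
by rewrite size_nseq xFE.
Qed.

(** The indices are the distinct entries of [F] in increasing order and the
    exponents are their multiplicities, which add up to the number of cells. *)
Lemma rsct_xF_eq_xpow {n : nat} {a : seq nat} {F : filling} :
  is_composition n a -> is_rsct a F ->
  exists b s, [/\ is_composition n b, increasing_indices (size b) s
                & xF F = xpow s b].
Proof.
move=> [_ an] [Fa F1 _ _ _].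
pose s := sort leq (undup (flatten F)).
have ms i : (i \in s) = (i \in flatten F) by rewrite mem_sort mem_undup.
have us : uniq s by rewrite sort_uniq undup_uniq.
exists [seq xF F i | i <- s], s; split.
- split.
    by apply/allP => _ /mapP[i + ->]; rewrite ms xFE -has_pred1 has_count.
  rewrite -an -Fa -xF_degree; apply: perm_sumn.
  by rewrite perm_map // perm_sort.
- split; first by rewrite size_map.
    by apply/allP => i; rewrite ms => /flattenP[r /(allP F1)/allP]; apply.
  by rewrite ltn_sorted_uniq_leq us sort_sorted //; exact: leq_total.
- apply: xF_xpow_intro => // [i|j js]; first by rewrite ms.
  by rewrite (nth_map 0%N) // xFE.
Qed.

(** * Relabelling the entries of a tableau *)

Lemma hat_map {g : nat -> nat} {F : filling} {i j : nat} : g 0%N = 0%N ->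
  hat [seq [seq g x | x <- r] | r <- F] i j = g (hat F i j).
Proof.
move=> g0; rewrite /hat.
have [iF|iF] := ltnP i (size F); last first.
  by rewrite !(nth_default [::]) ?size_map // !nth_nil g0.
rewrite (nth_map [::]) //.
have [jr|jr] := ltnP j (size (nth [::] F i)); first by rewrite (nth_map 0%N).
by rewrite !(nth_default 0%N) ?size_map // g0.
Qed.

Lemma mem_hat {F : filling} {i j : nat} : hat F i j \in 0%N :: flatten F.
Proof.
rewrite inE /hat.
have [iF|iF] := ltnP i (size F); last by rewrite (nth_default [::]) // nth_nil.
have [jr|jr] := ltnP j (size (nth [::] F i)); last by rewrite nth_default.
apply/orP; right; apply/flattenP; exists (nth [::] F i); exact: mem_nth.
Qed.

(** Every condition on a tableau is a comparison between entries of the padded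
    array, positivity being the comparison with 0.  This is why 0 is fixed by
    [g] and belongs to the set on which [g] is monotone. *)
Lemma is_rsct_map {a : seq nat} {g : nat -> nat} {F : filling} :
  g 0%N = 0%N -> {in 0%N :: flatten F &, {mono g : x y / (x <= y)%N}} ->
  is_rsct a F -> is_rsct a [seq [seq g x | x <- r] | r <- F].
Proof.
move=> g0 gle [Fa F1 Fdec Fcol Frow].
have glt : {in 0%N :: flatten F &, {mono g : x y / (x < y)%N}}.
  by move=> x y xF yF; rewrite !ltnNge gle.
have mF x r : r \in F -> x \in r -> x \in 0%N :: flatten F.
  by move=> rF xr; rewrite inE; apply/orP; right; apply/flattenP; exists r.
split.
- by rewrite -Fa /shape -map_comp; apply: eq_map => r /=; rewrite size_map.
- apply/allP => _ /mapP[r rF ->]; apply/allP => _ /mapP[x xr ->].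
  rewrite -g0 glt ?mem_head ?(mF x r) //.
  exact: (allP (allP F1 _ rF)).
- apply/allP => _ /mapP[r rF ->].
  have ggt : {in 0%N :: flatten F &, {mono g : x y / gtn x y >-> gtn x y}}.
    by move=> x y xF yF; exact: glt.
  by rewrite (mono_sorted_in ggt) ?(allP Fdec) //; apply/allP => x; exact: mF.
- have -> : [seq hat [seq [seq g x | x <- r] | r <- F] i 0 | i <- iota 0 (size a)]
     = [seq g x | x <- [seq hat F i 0 | i <- iota 0 (size a)]].
    by rewrite -map_comp; apply: eq_map => i; exact: hat_map.
  rewrite (mono_sorted_in gle) //.
  by apply/allP => _ /mapP[i _ ->]; exact: mem_hat.
- move=> i j k ij k1; rewrite !hat_map // glt ?gle ?mem_hat //; exact: Frow.
Qed.

(** The order isomorphism from [0 :: s] to [0 :: t] when these are increasing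
    of the same length; putting 0 in front makes it fix the padding value. *)
Definition relabel (s t : seq nat) (i : nat) : nat :=
  nth 0%N (0%N :: t) (index i (0%N :: s)).

Lemma relabelK {s t : seq nat} : size s = size t -> uniq (0%N :: t) ->
  {in 0%N :: s, cancel (relabel s t) (relabel t s)}.
Proof.
move=> st ut i si; rewrite /relabel index_uniq ?nth_index //.
by rewrite [size (_ :: t)]/= -st index_mem.
Qed.

Lemma relabel_mono {s t : seq nat} : size s = size t ->
  sorted ltn (0%N :: s) -> sorted ltn (0%N :: t) ->
  {in 0%N :: s &, {mono relabel s t : x y / (x <= y)%N}}.
Proof.
move=> st ss tt; apply: leq_mono_in => x y xs ys xy.
have lt_size z : z \in 0%N :: s -> (index z (0%N :: s) < size (0%N :: t))%N.
  by rewrite -index_mem [size (_ :: s)]/= st.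
apply: (sorted_ltn_nth ltn_trans); rewrite ?inE ?lt_size //.
case: ltngtP => // [/(sorted_ltn_index ltn_trans ss _ _ ys xs)|eq_xy].
  by rewrite ltnNge (ltnW xy).
by move: xy; rewrite -(nth_index 0%N xs) eq_xy nth_index // ltnn.
Qed.

Definition rsct_of_xF (a : seq nat) (m : monom) : set filling :=
  [set F | is_rsct a F /\ xF F = m].

Lemma map_relabelK {s t : seq nat} {F : filling} :
  size s = size t -> uniq (0%N :: t) -> {subset flatten F <= s} ->
  map (map (relabel t s)) (map (map (relabel s t)) F) = F.
Proof.
move=> st ut Fs; rewrite -map_comp map_id_in // => r rF /=.
rewrite -map_comp map_id_in // => x xr /=; apply: relabelK => //.
by rewrite inE Fs ?orbT //; apply/flattenP; exists r.
Qed.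

Lemma relabel_rsct {a b s t : seq nat} {F : filling} :
  increasing_indices (size b) s -> increasing_indices (size b) t ->
  rsct_of_xF a (xpow s b) F ->
  rsct_of_xF a (xpow t b) (map (map (relabel s t)) F).
Proof.
move=> sb tb [Fa Fm]; have Fs := xF_xpow_flatten Fm.
have [ss st] := (increasing_cons0 sb, increasing_cons0 tb).
have [us ut] := (increasing_uniq sb, increasing_uniq tb).
have szst : size s = size t by case: sb => ->; case: tb => ->.
have us0 := sorted_uniq ltn_trans ltnn ss.
have relj j : (j < size s)%N -> relabel s t (nth 0%N s j) = nth 0%N t j.
  by move=> js; rewrite /relabel -[nth 0%N s j]/(nth 0%N (0%N :: s) j.+1) index_uniq.
split.
  apply: is_rsct_map => //; apply: sub_in2 (relabel_mono szst ss st) => i.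
  by rewrite !inE => /predU1P[->//|/Fs ->]; rewrite orbT.
apply: xF_xpow_intro => // [x|j]; rewrite -map_flatten.
  by case/mapP => i /Fs /(nthP 0%N)[j js <-] ->; rewrite relj // mem_nth // -szst.
rewrite -szst => js; rewrite -relj // count_map.
rewrite -(xpow_nth (b := b) us js) -Fm xFE; apply: eq_in_count => i /Fs si /=.
rewrite (inj_in_eq (incn_inj_in (relabel_mono szst ss st))) //.
  by rewrite inE si orbT.
by rewrite inE mem_nth ?orbT.
Qed.

(** Relabelling from [s] to [t] is a bijection between the two sets of
    tableaux; its inverse is relabelling from [t] to [s]. *)
Lemma card_rsct_xpow {a b s t : seq nat} :
  increasing_indices (size b) s -> increasing_indices (size b) t ->
  #|` fset_set (rsct_of_xF a (xpow s b))|%fset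
    = #|` fset_set (rsct_of_xF a (xpow t b))|%fset.
Proof.
move=> sb tb.
have us := sorted_uniq ltn_trans ltnn (increasing_cons0 sb).
have ut := sorted_uniq ltn_trans ltnn (increasing_cons0 tb).
have szst : size s = size t by case: sb => ->; case: tb => ->.
have -> : rsct_of_xF a (xpow t b)
    = map (map (relabel s t)) @` rsct_of_xF a (xpow s b).
  apply/seteqP; split=> [F tF|_ [F sF <-]]; last exact: relabel_rsct sF.
  exists (map (map (relabel t s)) F); first exact: relabel_rsct tF.
  by case: tF => _ /xF_xpow_flatten; exact: map_relabelK.
have fin : finite_set (rsct_of_xF a (xpow s b)) by exact: finite_rsct_xF.
rewrite fset_set_image // card_in_imfset //.
apply: (can_in_inj (g := map (map (relabel t s)))) => F.
rewrite in_fset_set // inE => -[_ /xF_xpow_flatten]; exact: map_relabelK.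
Qed.

(** * Coefficients of both sides *)

Lemma RS_coef (R : comNzRingType) (a : seq nat) (m : monom) :
  RS R a m = #|` fset_set (rsct_of_xF a m)|%fset%:R.
Proof.
transitivity (\sum_(F \in rsct_of_xF a m) (1 : R)); last first.
  rewrite fsbig_finite; last exact: finite_rsct_xF.
  by rewrite big_const_seq count_predT iter_addr_0.
rewrite -[LHS](@fsbig_widen _ _ _ _ (rsct_of_xF a m)) => [|F []//|F [aF mF]].
  by apply: eq_fsbigr => F; rewrite inE => -[_ <-]; rewrite /mono eqxx.
by rewrite /= /mono; case: eqVneq => // mFE; case: mF.
Qed.

Lemma M_coef (R : comNzRingType) {b c t : seq nat} :
  all (leq 1) b -> all (leq 1) c -> increasing_indices (size c) t ->
  M R b (xpow t c) = (b == c)%:R.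
Proof.
move=> b1 c1 tc; rewrite /M /fsum /mono.
have [eq_bc|neq_bc] := eqVneq b c; last first.
  apply: fsbig1 => s sb; case: eqVneq => // /esym /(xpow_inj b1 c1 sb tc)[_ bc].
  by rewrite bc eqxx in neq_bc.
subst b; rewrite -(@fsbig_widen _ _ _ _ [set t]) => [|_ -> //|s [sc st]].
  by rewrite fsbig_set1 eqxx.
rewrite /=; case: eqVneq => // /esym /(xpow_inj c1 c1 sc tc)[/st].
by [].
Qed.

Lemma M_coef0 (R : comNzRingType) {b : seq nat} {m : monom} :
  (forall s, increasing_indices (size b) s -> m <> xpow s b) -> M R b m = 0.
Proof.
by move=> mb; apply: fsbig1 => s /mb; rewrite /mono; case: eqVneq.
Qed.

Theorem mainTheorem5 (R : comNzRingType) (n : nat) (a : seq nat)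
    (ha : is_composition n a) :
  RS R a = \sum_(b \in [set b : seq nat | is_composition n b]) M R b *+ K a b.
Proof.
have fin := finite_compositions n.
apply/funext => m; rewrite RS_coef fsbig_finite // fct_sumE.
under eq_bigr do rewrite natmulfctE.
rewrite -(@fsbig_finite _ _ _ _ _ (fun b => M R b m *+ K a b)) //.
have [[c [t [cn tc ->]]]|no_m] := pselect (exists b s,
    [/\ is_composition n b, increasing_indices (size b) s & m = xpow s b]).
  (* Only the composition c contributes to the coefficient of x_t^c. *)
  have [c1 _] := cn.
  rewrite -(@fsbig_widen _ _ _ _ [set c]) => [|_ -> //|b [[b1 _] bc]].
    rewrite fsbig_set1 (M_coef R c1 c1 tc) eqxx; congr (_ *+ _).
    have ic : increasing_indices (size c) (iota 1 (size c)).
      split; first exact: size_iota.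
        by apply/allP => i; rewrite mem_iota => /andP[].
      exact: iota_ltn_sorted.
    exact: card_rsct_xpow tc ic.
  rewrite /= (M_coef R b1 c1 tc); case: eqVneq => [/bc //|_].
  exact: mul0rn.
(* No tableau and no M_b involves the monomial m. *)
have -> : rsct_of_xF a m = set0.
  apply/seteqP; split=> // F [aF Fm]; apply: no_m.
  by have [b [s [bn sb Fs]]] := rsct_xF_eq_xpow ha aF; exists b, s; rewrite -Fm.
rewrite fset_set0 cardfs0 fsbig1 // => b bn.
rewrite M_coef0 ?mul0rn // => s sb ms; apply: no_m.
by exists b, s.
Qed.
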